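(* Let $S\subseteq\omega_1$ be stationary and co-stationary, and let $T=T(S)$. Then there is a subgraph $X$ of the comparability graph $G(T)$ such that $Chr(X)=\omega_1$ and any two $<_T$-incomparable vertices $s,t$ are separated by a finite set in $X$ (i.e. there is a finite set $F$ of vertices such that every path in $X$ from $s$ to $t$ meets $F$). In particular, every uncountable set $A\subseteq T$ contains two vertices which are separated by a finite set in $X$.
   Context: $T(S)$ denotes the tree of all closed (in the order topology of $\omega_1$) countable subsets $t\subseteq S$, ordered by $s\leq t$ iff $s$ is an initial segment of $t$. For a tree $(T,\leq)$, the comparability graph $G(T)$ has vertex set $T$ and an edge between distinct $x,y$ iff $x\leq y$ or $y\leq x$. $Chr(X)$ is the chromatic number of $X$. *)

(* Defs.v *)
From HB Require Import structures.
From mathcomp Require Import all_boot all_order.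
From mathcomp Require Import all_classical topology.
From mathcomp Require Import wochoice.

Set Implicit Arguments.
Unset Strict Implicit.
Unset Printing Implicit Defensive.

Import Order.TTheory.

Local Open Scope classical_set_scope.
Local Open Scope card_scope.
Local Open Scope order_scope.

(* omega_1 is used up to isomorphism: it is the unique order type of an
   uncountable well-order all of whose proper initial segments are countable.
   Being an orderTopologicalType, W carries the order topology, so the library
   predicate [closed] refers to that topology. *)
Definition is_omega1 d (W : orderTopologicalType d) : Prop :=
  [/\ well_order (fun x y : W => x <= y),
      ~ countable [set: W] &
      forall a : W, countable [set x | x < a]].

Definition unbounded d (W : orderTopologicalType d) (C : set W) : Prop :=
  forall a : W, exists2 b, C b & a < b.

Definition stationary d (W : orderTopologicalType d) (S : set W) : Prop :=
  forall C : set W, closed C -> unbounded C -> S `&` C !=set0.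

(* The vertices are the members of a set of elements of the ambient type V. *)
Record graph (V : eqType) := Graph {
  vertices : set V;
  adj : rel V;
  adj_vertices : forall x y, adj x y -> vertices x /\ vertices y;
  adj_sym : symmetric adj;
  adj_irrefl : irreflexive adj
}.

Definition subgraph (V : eqType) (X G : graph V) : Prop :=
  vertices X `<=` vertices G /\ subrel (adj X) (adj G).

Definition colorable (V : eqType) (X : graph V) (U : Type) (C : set U) : Prop :=
  exists f : V -> U,
    set_fun (vertices X) C f /\ forall x y, adj X x y -> f x <> f y.

(* Chr(X) = |K|: the cardinal |K| is the least one for which X has a proper
   coloring with that many colors. *)
Definition chromatic_number_is (V : eqType) (X : graph V)
    (U : Type) (K : set U) : Prop :=
  colorable X K /\
  forall (U' : Type) (C : set U'), colorable X C -> K #<= C.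

(* x :: p is the list of vertices of a path in X from x to y. *)
Definition graph_path (V : eqType) (X : graph V) (x y : V) (p : seq V) : Prop :=
  [/\ path (adj X) x p, uniq (x :: p) & last x p = y].

(* The separating set may not contain s or t; otherwise F = [set s] would
   separate any two vertices. *)
Definition finitely_separated (V : eqType) (X : graph V) (s t : V) : Prop :=
  exists F : set V,
    [/\ finite_set F, F `<=` vertices X, ~ F s, ~ F t &
        forall p, graph_path X s t p -> exists2 z, z \in s :: p & F z].

Section Comparability.
Variables (V : eqType) (T : set V) (le : V -> V -> Prop).

Definition comparable_in (x y : V) : Prop := le x y \/ le y x.

Definition comparability_adj : rel V := fun x y =>
  `[< [/\ T x, T y, x <> y & comparable_in x y] >].

Fact comparability_adj_vertices x y : comparability_adj x y -> T x /\ T y.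
Proof. by move=> /asboolP[]. Qed.

Fact comparability_adj_sym : symmetric comparability_adj.
Proof.
move=> x y; apply/asboolP/asboolP => -[Tx Ty xy cxy];
  by split=> //; [exact/nesym | case: cxy; [right|left]].
Qed.

Fact comparability_adj_irrefl : irreflexive comparability_adj.
Proof. by move=> x; apply/asboolP => -[_ _]. Qed.

Definition comparability_graph : graph V :=
  Graph comparability_adj_vertices comparability_adj_sym
    comparability_adj_irrefl.

End Comparability.

Definition closed_tree d (W : orderTopologicalType d) (S : set W) : set (set W) :=
  [set t | [/\ t `<=` S, closed t & countable t]].

Definition initial_segment d (W : orderTopologicalType d) (s t : set W) : Prop :=
  s `<=` t /\ forall x y, s x -> t y -> y <= x -> s y.

(* Main.v *)
(* Let [e mu] be an injection of [0, mu] into the naturals, and [n] a function to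
   the naturals that is unbounded on every tail of [S].  Join an initial segment
   [y], with maximum [b], to [x] when [e mu b <= n al] for all consecutive
   elements [mu < al] of [x] with [b <= mu].

   If [s] and [t] are incomparable and [al] is the first element of [s] where
   they differ, then, the sets being closed, [al] has a predecessor [mu] in [s].
   A path from [s] to [t] must leave the cone of nodes that agree with [s] up to
   [al], and it does so through an initial segment of [s] with maximum [b <= mu]
   such that [e mu b <= n al]; there are finitely many of these.

   Given a coloring of the tree by the naturals, build an increasing sequence of
   nodes with finite sets of promises: at stage [k], move to a node of color [k]
   that keeps all promises, if there is one, and promise to keep its maximum;
   then go on with an element of [S] as large as required.  As [S] is stationary,
   the supremum of the nodes can be taken in [S], which makes their union with
   that supremum a node [x].  If [x] has color [k], then [x] shows that a node of
   color [k] was found at stage [k], and that node is adjacent to [x]. *)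
Require Import Defs.
From HB Require Import structures.
From mathcomp Require Import all_boot all_order.
From mathcomp Require Import all_classical topology.
From mathcomp Require Import interval finmap.

Set Implicit Arguments.
Unset Strict Implicit.
Unset Printing Implicit Defensive.

Local Open Scope classical_set_scope.

Lemma countable_setU (T : Type) (A B : set T) :
  countable A -> countable B -> countable (A `|` B).
Proof.
by move=> cA cB; rewrite -bigcup2E; apply: bigcup_countable => // -[|[|i]] _ //=.
Qed.

(** * Suprema, closed sets and cardinality in $\omega_1$ *)

Section Omega1.
Import Order.TTheory.
Local Open Scope order_scope.
Local Open Scope card_scope.
Context (d : Order.disp_t) (W : orderTopologicalType d)
  (W_omega1 : is_omega1 W).

Definition is_sup (B : set W) (m : W) : Prop :=
  (forall b, B b -> b <= m) /\ (forall a, a < m -> exists2 b, B b & a < b).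

Lemma omega1_min (B : set W) :
  B !=set0 -> exists2 m, B m & forall b, B b -> m <= b.
Proof.
move=> [b0 Bb0]; case: W_omega1 => wo _ _.
have [|m [[Bm lem] _]] := wo [pred x | `[< B x >]].
  by exists b0; apply/asboolP.
exists m; first exact/asboolP.
by move=> b Bb; apply: lem; apply/asboolP.
Qed.

Lemma countable_initial (a : W) : countable [set x | x <= a].
Proof.
have -> : [set x | x <= a] = [set x | x < a] `|` [set a].
  apply/seteqP; split=> x /=; last by case=> [/ltW//|->].
  by rewrite le_eqVlt => /orP[/eqP ->|xa]; [right|left].
by apply: countable_setU (countable1 a); case: W_omega1.
Qed.

Lemma countable_ubound (B : set W) :
  countable B -> exists a, forall b, B b -> b < a.
Proof.
move=> cB; apply: contrapT => noa; case: W_omega1 => _ + _; apply.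
suff -> : [set: W] = \bigcup_(b in B) [set x | x <= b].
  by apply: bigcup_countable => // b _; exact: countable_initial.
apply/seteqP; split=> // x _; apply: contrapT => nx; apply: noa.
by exists x => b Bb; rewrite ltNge; apply/negP => xb; apply: nx; exists b.
Qed.

Lemma omega1_gt (a : W) : exists b, a < b.
Proof.
have [b ab] := countable_ubound (countable1 a).
by exists b; exact: ab.
Qed.

Lemma sup_exists (B : set W) (a : W) :
  (forall b, B b -> b <= a) -> exists2 m, is_sup B m & m <= a.
Proof.
move=> Ba; have [|m mB lem] := @omega1_min [set u | forall b, B b -> b <= u].
  by exists a.
exists m; last exact: lem.
split=> // c cm; apply: contrapT => nb.
have /lem : forall b, B b -> b <= c; last by rewrite leNgt cm.
by move=> b Bb; rewrite leNgt; apply/negP => cb; apply: nb; exists b.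
Qed.

(** The closed ray []-oo, m]] contains [B], hence its closure, so [m] is also the supremum of
    [closure B]; a nonempty closed set contains its supremum. *)
Lemma closed_sup (A B : set W) (m : W) :
  closed A -> B !=set0 -> B `<=` A -> is_sup B m -> A m.
Proof.
move=> clA B0 BA [Bm mB]; suff clm : closure A m by exact: clA.
have Bsup : supremums B m.
  split=> [b /Bm//|u ub]; rewrite leNgt; apply/negP => /mB[b Bb].
  by rewrite ltNge (ub _ Bb).
apply: (@closure_subset _ _ _ BA).
have sc : supremums (closure B) m.
  split; last first.
    by move=> u ub; apply: Bsup.2 => b Bb; apply: ub; exact: subset_closure.
  move=> b; suff : closure B `<=` `]-oo, m]%classic.
    by move=> /[apply]; rewrite /= in_itv.
  have -> : `]-oo, m]%classic = closure `]-oo, m]%classic.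
    by apply: (closure_id _).1; exact: lray_closed.
  by apply: closure_subset => c /Bm; rewrite /= in_itv.
apply: itv_closed_supremums sc; last exact: closed_closure.
by case: B0 => b Bb; exists b; exact: subset_closure.
Qed.

(** Let [p] be the successor of [m]. The open ray below [p] has [m] as its maximum, so a closure
    point [m] of [A] is the supremum of the elements of [A] up to [m]. *)
Lemma closed_from_sup (A : set W) :
  (forall B m, B `<=` A -> B !=set0 -> is_sup B m -> A m) -> closed A.
Proof.
move=> supA m clm.
have [m' mm'] := omega1_gt m; have [|p mp lep] := @omega1_min [set x | m < x].
  by exists m'.
have ltp x : x < p -> x <= m.
  by move=> xp; rewrite leNgt; apply/negP => /lep; rewrite leNgt xp.
apply: (supA (A `&` [set x | x <= m])) => [x []//||].
  have mI : `]-oo, p[%classic m by rewrite /= in_itv.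
  have [x [Ax]] := clm _ (open_nbhs_nbhs (conj (lray_open p) mI)).
  by rewrite /= in_itv /= => /ltp xm; exists x.
split=> [x []//|a am].
have mI : `]a, p[%classic m by rewrite /= in_itv /= am.
have [x [Ax]] := clm _ (open_nbhs_nbhs (conj (itv_open a p) mI)).
by rewrite /= in_itv /= => /andP[ax /ltp xm]; exists x.
Qed.

Lemma closed_countable_max (A : set W) : closed A -> countable A -> A !=set0 ->
  exists2 m, A m & forall x, A x -> x <= m.
Proof.
move=> clA cA A0; have [a Aa] := countable_ubound cA.
have [|m mA _] := @sup_exists A a; first by move=> b /Aa/ltW.
by exists m; [exact: closed_sup mA|case: mA].
Qed.

Lemma omega1_ind (P : W -> Prop) :
  (forall a, (forall b, b < a -> P b) -> P a) -> forall a, P a.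
Proof.
move=> stepP a; apply: contrapT => nPa.
have [|m nPm lem] := @omega1_min [set x | ~ P x]; first by exists a.
apply: nPm; apply: stepP => b bm; apply: contrapT => /lem.
by rewrite leNgt bm.
Qed.

Lemma omega1_wf : well_founded (fun x y : W => x < y).
Proof. by move=> a; elim/omega1_ind: a => a IH; constructor. Qed.

(** Well-founded recursion chooses for each [a] an element of [C] different from those chosen below
    [a]; one remains because these are countably many. *)
Lemma uncountable_card_ge (U : Type) (C : set U) :
  ~ countable C -> [set: W] #<= C.
Proof.
elim/Pchoice: U => U in C * => nC.
have [c0 Cc0] : C !=set0.
  apply: contrapT => /set0P/negP; rewrite negbK => /eqP C0; apply: nC.
  by rewrite C0; exact: countable0.
have avoid (a : W) (h : W -> U) : exists c, C c /\ forall b, b < a -> h b <> c.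
  apply: contrapT => no; apply: nC.
  apply: (@sub_countable _ _ _ [set x | x < a]); last by case: W_omega1.
  apply: card_le_trans (card_image_le h _).
  apply: subset_card_le => c Cc; apply: contrapT => nc; apply: no.
  by exists c; split=> // b ba hb; apply: nc; exists b.
pose F (a : W) (h : forall b, b < a -> U) : U :=
  xget c0 [set c | C c /\ forall b (ba : b < a), h b ba <> c].
pose h := Fix omega1_wf (fun=> U) F.
have hE a : h a = F a (fun b _ => h b).
  rewrite {1}/h Fix_eq // => x f g fg; congr F.
  apply: functional_extensionality_dep => y.
  exact: functional_extensionality_dep (fg y).
have hP a : C (h a) /\ forall b, b < a -> h b <> h a.
  have [c cP] := avoid a h; rewrite hE.
  apply: (@xgetPex _ c0 [set c | C c /\ forall b, b < a -> h b <> c]).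
  by exists c.
have h_inj : {in [set: W] &, injective h}.
  move=> a b _ _ hab; have [ab|ba|//] := ltgtP a b.
    by case: (hP b) => _ /(_ _ ab).
  by case: (hP a) => _ /(_ _ ba) [].
rewrite -(card_le_eql (inj_card_eq h_inj)).
by apply: subset_card_le => _ [a _ <-]; case: (hP a).
Qed.

End Omega1.

(** * Injections into the naturals and closed unbounded sets *)

Section Clubs.
Import Order.TTheory.
Local Open Scope order_scope.
Local Open Scope card_scope.
Context (d : Order.disp_t) (W : orderTopologicalType d)
  (W_omega1 : is_omega1 W).

Lemma stationary_unbounded (S : set W) : stationary S -> unbounded S.
Proof.
move=> stS a; have [b ab] := omega1_gt W_omega1 a.
have clC : closed [set x | b <= x].
  have -> : [set x | b <= x] = `[b, +oo[%classic.
    by apply/seteqP; split=> x /=; rewrite in_itv /= andbT.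
  exact: rray_closed.
have unC : unbounded [set x | b <= x].
  move=> c; have [u] := omega1_gt W_omega1 (Order.max b c).
  by rewrite gt_max => /andP[/ltW bu cu]; exists u.
have [c [Sc bc]] := stS _ clC unC.
by exists c => //; exact: lt_le_trans ab bc.
Qed.

(** The injections for different [mu] are chosen independently; no agreement between them is
    claimed. *)
Lemma exists_coherent_injections :
  exists e : W -> W -> nat,
    forall mu x y, x <= mu -> y <= mu -> e mu x = e mu y -> x = y.
Proof.
have inj (mu : W) : exists h : W -> nat,
    forall x y, x <= mu -> y <= mu -> h x = h y -> x = y.
  have /countable_injP[h hP] := countable_initial W_omega1 mu.
  by exists h => x y xm ym; apply: hP; apply/mem_set.
by have [e eP] := choice inj; exists e.
Qed.

(** Take [n al := e al b] for a suitable [b]. If every [b] failed, infinitely many would share a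
    bound [k], as [W] is uncountable; but for [al] in [S] large enough, [e al] would map [k + 1] of
    them injectively into [k] values. *)
Lemma exists_unbounded_level (S : set W) : unbounded S ->
  exists n : W -> nat, forall k a, exists2 al, S al & a < al /\ (k <= n al)%N.
Proof.
move=> unS; have [e eP] := exists_coherent_injections.
suff [b bP] : exists b, forall k a,
    exists2 al, S al & a < al /\ (k <= e al b)%N.
  by exists (fun al => e al b).
apply: contrapT => nob.
have {nob} /choice[ka kaP] (b : W) : exists ka : nat * W,
    forall al, S al -> ka.2 < al -> (e al b < ka.1)%N.
  apply: contrapT => nka; apply: nob; exists b => k a.
  apply: contrapT => nal; apply: nka; exists (k, a) => al Sal /= aal.
  by rewrite ltnNge; apply/negP => kle; apply: nal; exists al.
have [k kinf] : exists k, infinite_set [set b | (ka b).1 = k].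
  apply: contrapT => fin; case: W_omega1 => _ + _; apply.
  have -> : [set: W] = \bigcup_k [set b | (ka b).1 = k].
    by apply/seteqP; split=> // b _; exists (ka b).1.
  apply: bigcup_countable => // k _; apply: finite_set_countable.
  by apply: contrapT => kinf; apply: fin; exists k.
have [B Bk szB] := infinite_set_fset k.+1 kinf.
have cB : countable ([set` B] `|` [set (ka b).2 | b in [set` B]]).
  apply: finite_set_countable; rewrite finite_setU; split=> //.
  exact: finite_image.
have [a aP] := countable_ubound W_omega1 cB; have [al Sal aal] := unS a.
have : (size [seq e al b | b <- B] <= size (iota 0 k))%N.
  apply: uniq_leq_size => [|_ /mapP[b bB ->]].
    rewrite map_inj_in_uniq ?fset_uniq // => x y xB yB; apply: eP.
      by apply/ltW/(lt_trans _ aal)/aP; left.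
    by apply/ltW/(lt_trans _ aal)/aP; left.
  rewrite mem_iota /= add0n -(Bk _ bB); apply: kaP => //.
  by apply: lt_trans aal; apply: aP; right; exists b.
by rewrite size_map size_iota leqNgt szB.
Qed.
Lemma countable_words (D : set W) :
  countable D -> countable [set w : seq W | {in w, forall a, D a}].
Proof.
move=> /countable_injP[f f_inj]; apply/countable_injP.
exists (fun w => choice.pickle (map f w)) => w w' /set_mem/= + /set_mem/= +.
move=> Dw Dw' /(pcan_inj choice.pickleK).
elim: w w' Dw Dw' => [|a w IH] [|b w'] //= Dw Dw' [fab fww'].
rewrite (f_inj a b _ _ fab); first congr cons; first apply: IH => //.
- by move=> c cw; apply: Dw; rewrite inE cw orbT.
- by move=> c cw; apply: Dw'; rewrite inE cw orbT.
- by apply/mem_set/Dw; rewrite inE eqxx.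
- by apply/mem_set/Dw'; rewrite inE eqxx.
Qed.

(** A finite word below a supremum lies below one of the elements approaching it, whence closedness.
    For the same reason, the supremum of the iterates of [g] from [a0] is a member of [C] above
    [a0]. *)
Lemma club_closure_points (h : seq W -> set W) :
  (forall w, countable (h w)) ->
  let C := [set dl | forall w, {in w, forall a, a < dl} ->
                               forall c, h w c -> c < dl] in
  closed C /\ unbounded C.
Proof.
move=> ch C; split.
  apply: closed_from_sup => // B m BC [b0 Bb0] [Bm mB] w wm c hc.
  have [b Bb wb] : exists2 b, B b & {in w, forall a, a < b}.
    elim: w wm {hc} => [|a w IH] wm; first by exists b0.
    have [|b Bb wb] := IH; first by move=> x xw; apply: wm; rewrite inE xw orbT.
    have [b' Bb' ab'] := mB _ (wm a (mem_head _ _)).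
    have [bb'|/ltW b'b] := leP b b'.
      exists b' => // x; rewrite inE => /orP[/eqP -> //|/wb xb].
      exact: lt_le_trans xb bb'.
    exists b => // x; rewrite inE => /orP[/eqP ->|/wb //].
    exact: lt_le_trans ab' b'b.
  by apply: lt_le_trans (Bm _ Bb); exact: (BC _ Bb w).
move=> a0.
have /choice[g gP] (dl : W) : exists g, dl < g /\
    forall w, {in w, forall a, a <= dl} -> forall c, h w c -> c < g.
  have cH : countable ([set dl] `|`
      \bigcup_(w in [set w : seq W | {in w, forall a, a <= dl}]) h w).
    apply: countable_setU; first exact: countable1.
    apply: bigcup_countable => //.
    exact: countable_words (countable_initial W_omega1 dl).
  have [g gP] := countable_ubound W_omega1 cH; exists g.
  by split=> [|w wdl c hc]; apply: gP; [left|right; exists w].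
pose u i := iter i g a0.
have u_mono i j : (i <= j)%N -> u i <= u j.
  elim: j => [|j IH]; first by rewrite leqn0 => /eqP ->.
  rewrite leq_eqVlt => /orP[/eqP -> //|/IH ij].
  by apply: le_trans ij _; apply/ltW; exact: (gP _).1.
have cu : countable (range u) by apply: sub_countable (card_image_le _ _) _.
have [a aP] := countable_ubound W_omega1 cu.
have [|m [um mu] _] := @sup_exists _ _ W_omega1 (range u) a.
  by move=> b /aP/ltW.
have u_lt i : u i < m.
  by apply: (lt_le_trans (gP (u i)).1); apply: um; exists i.+1.
exists m; last exact: (u_lt 0%N).
move=> w wm c hc.
have [i wi] : exists i, {in w, forall a, a <= u i}.
  elim: w wm {hc} => [|b w IH] wm; first by exists 0%N.
  have [|i wi] := IH; first by move=> x xw; apply: wm; rewrite inE xw orbT.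
  have [_ [j _ <-] bj] := mu _ (wm b (mem_head _ _)).
  exists (maxn i j) => x; rewrite inE => /orP[/eqP ->|/wi xi].
    by apply: le_trans (ltW bj) _; apply: u_mono; exact: leq_maxr.
  by apply: le_trans xi _; apply: u_mono; exact: leq_maxl.
by apply: lt_trans (u_lt i.+1); exact: (gP _).2 wi _ hc.
Qed.
End Clubs.

(** * The graph and its coloring by $\omega_1$ *)

Section LadderGraph.
Import Order.TTheory.
Local Open Scope order_scope.
Local Open Scope card_scope.
Context (d : Order.disp_t) (W : orderTopologicalType d)
  (W_omega1 : is_omega1 W) (S : set W) (e : W -> W -> nat) (n : W -> nat).
Local Notation T := (closed_tree S).
Local Notation init := (@initial_segment d W).

Lemma initial_segment_trans (r s t : set W) : init r s -> init s t -> init r t.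
Proof.
move=> [rs rsP] [st stP]; split=> [x /rs/st//|x y rx ty yx].
by apply: (rsP x) => //; apply: (stP x) => //; exact: rs.
Qed.

Lemma initial_segment_below (b : W) (t : set W) :
  init (t `&` [set x | x <= b]) t.
Proof.
split=> [x []//|x y [_ xb] ty yx]; split=> //.
  exact: le_trans yx xb.
Qed.

Definition is_max (y : set W) (b : W) : Prop := y b /\ forall x, y x -> x <= b.

Lemma initial_segment_maxE (y x : set W) b :
  init y x -> is_max y b -> y = x `&` [set c | c <= b].
Proof.
move=> [yx yxP] [yb by_]; apply/seteqP; split=> c.
  by move=> yc; split; [exact: yx|exact: by_].
by move=> [xc cb]; apply: yxP cb.
Qed.

Lemma closed_tree_max (t : set W) : T t -> t !=set0 -> exists b, is_max t b.
Proof.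
move=> [_ clt ct] t0; have [b tb bt] := closed_countable_max W_omega1 clt ct t0.
by exists b.
Qed.

Definition consecutive (x : set W) (mu al : W) : Prop :=
  [/\ x mu, x al, mu < al & forall c, x c -> c < al -> c <= mu].

Lemma consecutive_initial (r x : set W) mu al :
  init r x -> r al -> consecutive x mu al -> consecutive r mu al.
Proof.
move=> [rx rxP] ral [xmu xal mual muP]; split=> //.
  by apply: rxP (ltW mual).
by move=> c /rx; exact: muP.
Qed.

(* [A] is the list of maxima of the initial segments that are to remain
   potential neighbors as [r] grows to [x]. *)
Definition extends_keeping (r : set W) (A : seq W) (x : set W) : Prop :=
  init r x /\ forall mu al b,
    consecutive x mu al -> ~ r al -> b \in A -> (e mu b <= n al)%N.

Lemma extends_keeping_trans (r s x : set W) (A B : seq W) :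
  {subset A <= B} -> extends_keeping r A s -> extends_keeping s B x ->
  extends_keeping r A x.
Proof.
move=> AB [rs rsP] [sx sxP]; split; first exact: initial_segment_trans sx.
move=> mu al b cx nral bA; have [sal|nsal] := pselect (s al).
  by apply: rsP bA => //; exact: consecutive_initial cx.
by apply: sxP cx nsal _; exact: AB.
Qed.

(** As [y] is an initial segment of [x] with maximum [b], a consecutive pair [mu < al] of [x]
    satisfies [~ y al] exactly when [b <= mu]. *)
Definition ladder_edge (y x : set W) : Prop :=
  y <> x /\ exists2 b, is_max y b & extends_keeping y [:: b] x.

Definition ladder_adj : rel (set W) := fun x y =>
  `[< [/\ T x, T y & ladder_edge x y \/ ladder_edge y x] >].

Fact ladder_adj_vertices x y : ladder_adj x y -> T x /\ T y.
Proof. by move=> /asboolP[]. Qed.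

Fact ladder_adj_sym : symmetric ladder_adj.
Proof.
move=> x y; apply/asboolP/asboolP => -[Tx Ty [?|?]]; split=> //;
  by [right|left].
Qed.

Fact ladder_adj_irrefl : irreflexive ladder_adj.
Proof. by move=> x; apply/asboolP => -[_ _ [] []]. Qed.

Definition ladder_graph : graph (set W) :=
  Graph ladder_adj_vertices ladder_adj_sym ladder_adj_irrefl.

Lemma ladder_subgraph : subgraph ladder_graph (comparability_graph T init).
Proof.
split=> // x y /asboolP[Tx Ty xy]; apply/asboolP; split=> //.
  by case: xy => -[]// ? _; exact: nesym.
by case: xy => -[_ [b _ []]]; [left|right].
Qed.

(** The color is the maximum: an initial segment with the same maximum as the whole is the whole.
    The empty node, colored by a default, has no edges. *)
Lemma ladder_colorable : colorable ladder_graph [set: W].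
Proof.
have /choice[f fP] (y : set W) : exists m, forall b, is_max y b -> b = m.
  have [[m [ym my]]|nom] := pselect (exists m, is_max y m).
    by exists m => b [yb by_]; apply/eqP; rewrite eq_le my // by_.
  have [a _] : [set: W] !=set0.
    apply: contrapT => /set0P/negP; rewrite negbK => /eqP W0.
    by case: W_omega1 => _ + _; rewrite W0; apply; exact: countable0.
  by exists a => b yb; case: nom; exists b.
exists f; split=> // x y /asboolP[].
wlog edge : x y / ladder_edge x y => [wl Tx Ty [xy|yx]|Tx Ty _].
- by apply: wl => //; left.
- by apply: nesym; apply: wl => //; left.
move: edge => [xy [b xb [ixy _]]] fxy; apply: xy.
have [|m ym] := closed_tree_max Ty.
  by exists b; apply: ixy.1; case: xb.
have bm : b = m by rewrite (fP _ _ xb) fxy -(fP _ _ ym).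
rewrite (initial_segment_maxE ixy xb) bm; apply/seteqP; split=> [c []//|c yc].
by split=> //; exact: ym.2.
Qed.

(** * Finite separation, and incomparable nodes in uncountable sets *)

Context
  (e_inj : forall mu x y, x <= mu -> y <= mu -> e mu x = e mu y -> x = y).

Lemma finite_admitted mu k : finite_set [set b | b <= mu /\ (e mu b <= k)%N].
Proof.
apply: (@card_le_finite _ _ _ `I_k.+1); last exact: finite_II.
apply/pcard_leP/injfunPex; exists (e mu) => [b [_ bk]//|a b].
by move=> /set_mem[am _] /set_mem[bm _]; exact: e_inj.
Qed.

(* Were the first disagreement [sg] a limit of elements of [s], these would be in
   [t] too and closedness would put [sg] in [t]: hence the predecessor. *)
Lemma splitting_point (s t : set W) : T s -> T t -> ~ init s t ->
  exists sg, [/\ s sg, ~ (forall c, c <= sg -> t c <-> s c) &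
    (exists2 c, s c & c < sg) -> exists mu, consecutive s mu sg].
Proof.
move=> [_ cls _] [_ clt _] nst.
have [|sg [ssg nag] min] :=
    @omega1_min _ _ W_omega1
      [set x | s x /\ ~ (forall c, c <= x -> t c <-> s c)].
  apply: contrapT => no; apply: nst.
  have agree x : s x -> forall c, c <= x -> t c <-> s c.
    by move=> sx; apply: contrapT => nx; apply: no; exists x.
  split=> [x sx|x y sx ty yx]; first exact/(agree x).
  exact/(agree x sx).
have agree x : s x -> x < sg -> forall c, c <= x -> t c <-> s c.
  move=> sx xsg; apply: contrapT => nx; have := min x (conj sx nx).
  by rewrite leNgt xsg.
exists sg; split=> // -[c0 sc0 c0sg].
have [|m msup msg] := @sup_exists _ _ W_omega1 (s `&` [set x | x < sg]) sg.
  by move=> b [_ /ltW].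
have B0 : (s `&` [set x | x < sg]) !=set0 by exists c0.
have sm : s m by apply: closed_sup cls B0 _ msup => x [].
have [mE|mnsg] := eqVneq m sg; last first.
  have {mnsg} msg : m < sg by rewrite lt_neqAle mnsg.
  by exists m; split=> // c sc csg; apply: msup.1.
have tsg : t sg.
  rewrite -mE; apply: closed_sup clt B0 _ msup => x [sx xsg].
  exact/(agree x sx xsg).
exfalso; apply: nag => c; rewrite le_eqVlt => /orP[/eqP -> //|].
rewrite -mE => /msup.2[b [sb bsg] /ltW cb].
exact: agree cb.
Qed.

Lemma ladder_separated (s t : set W) : T s -> T t ->
  ~ comparable_in init s t -> finitely_separated ladder_graph s t.
Proof.
move=> Ts Tt nst.
have [|sg [ssg nag muP]] := splitting_point Ts Tt.
  by move=> ?; apply: nst; left.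
(* If [sg] is the least element of [s], it has no predecessor and [mu := sg] is a placeholder: no
   edge then leaves the cone of nodes agreeing with [s] up to [sg]. *)
have {muP}[mu muP] : exists mu, (exists2 c, s c & c < sg) -> consecutive s mu sg.
  have [/muP[mu cmu]|no] := pselect (exists2 c, s c & c < sg); first by exists mu.
  by exists sg.
(* The bound on [e mu b] makes [F] finite; [b < sg] keeps [s] out of it. *)
pose D := [set b | b <= mu /\ (e mu b <= n sg)%N] `&` [set b | b < sg].
pose F := T `&` [set s `&` [set c | c <= b] | b in D].
exists F; split.
- apply: finite_setIr; apply: finite_image; apply: finite_setIl.
  exact: finite_admitted.
- by move=> v [].
- move=> [_ [b [_ /= bsg] sE]]; move: ssg; rewrite -sE => -[_ /=].
  by rewrite leNgt bsg.
- move=> [_ [b _ tE]]; apply: nst; right; rewrite -tE.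
  exact: initial_segment_below.
pose cone (u : set W) := forall c, c <= sg -> u c <-> s c.
have exit u v : cone u -> ~ cone v -> ladder_adj u v -> F v.
  move=> cu ncv /asboolP[_ Tv uv]; split=> //.
  have usg : u sg by apply/cu.
  (* The edge goes down: an end extension of [u] would stay in the cone, because [u] contains
     [sg]. *)
  have {uv} [_ [b vb [vu vuP]]] : ladder_edge v u.
    case: uv => // -[_ [b _ [[uv uvP] _]]]; case: ncv => c csg; rewrite -cu //.
    by split=> [vc|/uv//]; exact: uvP vc csg.
  have vE := initial_segment_maxE vu vb.
  have bsg : b < sg.
    rewrite ltNge; apply/negP => sgb; apply: ncv => c csg; rewrite -cu // vE.
    by split=> [[]//|uc]; split=> //; exact: le_trans csg sgb.
  have sb : s b by apply/(cu _ (ltW bsg)); apply: vu.1; case: vb.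
  have [smu _ musg mumax] : consecutive s mu sg by apply: muP; exists b.
  have bmu : b <= mu by exact: mumax.
  have cmu : consecutive u mu sg.
    split=> //; first exact/(cu _ (ltW musg)).
    by move=> c uc csg; apply: mumax => //; apply/(cu _ (ltW csg)).
  exists b.
    split=> //; split=> //; apply: vuP cmu _ _; last by rewrite inE.
    by move=> /vb.2; rewrite leNgt bsg.
  rewrite vE; apply/seteqP; split=> c [xc cb]; split=> //.
    by apply/cu => //; exact/ltW/(le_lt_trans cb).
  by apply/cu => //; exact/ltW/(le_lt_trans cb).
have leave p : forall u, cone u -> ~ cone (last u p) -> path ladder_adj u p ->
    exists2 z, z \in u :: p & F z.
  elim: p => [//|v p IH] u cu /= ncl /andP[uv vp].
  have [cv|ncv] := pselect (cone v); last first.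
    by exists v; [rewrite !inE eqxx orbT|exact: exit uv].
  by have [z zp Fz] := IH v cv ncl vp; exists z => //; rewrite inE zp orbT.
by move=> p [sp _ lastp]; apply: leave => //; rewrite lastp.
Qed.

(** The union of an uncountable chain would be a closed unbounded subset of [S], missing the
    stationary complement. It is unbounded because a bounded union has only countably many initial
    segments that are empty or have a maximum, and all nodes of the chain are among these. *)
Lemma uncountable_incomparable (A : set (set W)) :
  stationary (~` S) -> A `<=` T -> ~ countable A ->
  exists s t, [/\ A s, A t & ~ comparable_in init s t].
Proof.
move=> coS AT ncA; apply: contrapT => noinc.
have cmp s t : A s -> A t -> init s t \/ init t s.
  by move=> As At; apply: contrapT => nc; apply: noinc; exists s, t.
pose U := \bigcup_(t in A) t.
have initU t : A t -> init t U.
  move=> At; split=> [x tx|x y tx [s As sy] yx]; first by exists t.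
  have [[_ tP]|[st _]] := cmp t s At As; last exact: st.
  exact: tP yx.
have unU : unbounded U.
  move=> a; apply: contrapT => nob; apply: ncA.
  have Ua x : U x -> x <= a.
    by move=> Ux; rewrite leNgt; apply/negP => ax; apply: nob; exists x.
  have cI : countable ([set set0] `|` [set U `&` [set c | c <= b] | b in U]).
    apply: countable_setU; first exact: countable1.
    apply: (sub_countable (card_image_le _ _)).
    apply: (sub_countable (subset_card_le Ua)).
    exact: countable_initial.
  apply: (sub_countable (subset_card_le _) cI) => t At.
  have [/(closed_tree_max (AT _ At)) [b tb]|t0] := pselect (t !=set0).
    right; exists b; first by exists t => //; case: tb.
    by rewrite -(initial_segment_maxE (initU _ At) tb).
  by left; apply/seteqP; split=> // x tx; apply: t0; exists x.
have clU : closed U.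
  apply: closed_from_sup => // B m BU B0 mB.
  have [Bm _] := mB; have [b [t At tb] mb] := unU m.
  have [_ clt _] := AT t At; exists t => //.
  apply: closed_sup clt B0 _ mB => x Bx.
  apply: (initU t At).2 tb (BU _ Bx) _.
  by apply: le_trans (ltW mb); exact: Bm.
have [x [nSx [t At tx]]] := coS _ clU unU.
by apply: nSx; have [tS _ _] := AT t At; exact: tS.
Qed.

(** * Monochromatic edges: one stage of the construction *)

Context
  (n_unbounded : forall k a, exists2 al, S al & a < al /\ (k <= n al)%N).

(** A node with the list of the maxima promised so far. *)
Local Notation state := (set W * seq W)%type.

Definition valid (p : state) : Prop := T p.1 /\ p.1 !=set0.

Definition extends (p q : state) : Prop :=
  extends_keeping p.1 p.2 q.1 /\ {subset p.2 <= q.2}.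

(** Since [b] is among the promises, every node of the tree that properly extends [q.1] and keeps
    [q.2] is adjacent to [y]. *)
Definition captured (f : set W -> nat) (k : nat) (q : state) : Prop :=
  exists y b, [/\ T y, f y = k, is_max y b,
    extends_keeping y [:: b] q.1 & b \in q.2].

Definition next_state (f : set W -> nat) (k : nat) (a : W) (p q : state) :
    Prop :=
  [/\ valid q, extends p q, exists2 b, q.1 b & a < b &
      (exists z, [/\ T z, z !=set0, extends_keeping p.1 p.2 z & f z = k]) ->
      captured f k q].

Lemma extends_keeping_refl r A : extends_keeping r A r.
Proof. by split=> [|mu al b [_ ral _ _]] //; split. Qed.

Lemma closed_tree_setU1 (z : set W) al : T z -> S al -> T (z `|` [set al]).
Proof.
move=> [zS clz cz] Sal; split.
- by move=> x [/zS//|->].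
- by apply: closedU => //; rewrite -set_itv1; exact: itv_closed.
- exact: countable_setU (countable1 al).
Qed.

(** The only consecutive pair with a new upper element is [m < al]. *)
Lemma extends_keeping_setU1 (z : set W) (A : seq W) m al :
  is_max z m -> m < al -> (forall b, b \in A -> (e m b <= n al)%N) ->
  extends_keeping z A (z `|` [set al]).
Proof.
move=> [zm mz] mal eA; split.
  split=> [x zx|x y zx [//|-> alx]]; first by left.
  by have := lt_le_trans mal (le_trans alx (mz _ zx)); rewrite ltxx.
move=> mu b c [zmu zb mub mumax] nzb cA.
have bE : b = al by case: zb.
move: mub mumax; rewrite bE => mual mumax.
have -> : mu = m; last exact: eA.
apply/eqP; rewrite eq_le mumax //; last by left.
by case: zmu => [/mz -> //|muE]; move: mual; rewrite muE ltxx.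
Qed.

(** The node [z] is a candidate of color [k] if there is one, and [p.1] otherwise. As [n] is
    unbounded on every tail of [S], one more element [al] can be added so that the old promises and
    the new one, the maximum of [z], are kept. *)
Lemma next_state_exists f k a p : valid p -> exists q, next_state f k a p q.
Proof.
move=> [Tp p0].
have [z [Tz z0 pz fz]] : exists z, [/\ T z, z !=set0, extends_keeping p.1 p.2 z &
    (exists z, [/\ T z, z !=set0, extends_keeping p.1 p.2 z & f z = k]) -> f z = k].
  have [[z [Tz z0 pz fz]]|no] := pselect
    (exists z, [/\ T z, z !=set0, extends_keeping p.1 p.2 z & f z = k]).
    by exists z.
  by exists p.1; split=> //; exact: extends_keeping_refl.
have [m zm] := closed_tree_max Tz z0.
pose A := m :: p.2.
have [al Sal []] := n_unbounded (\max_(b <- A) e m b) (Order.max a m).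
rewrite gt_max => /andP[aal mal] nal.
have eA b : b \in A -> (e m b <= n al)%N.
  by move=> bA; apply: leq_trans nal; exact: leq_bigmax_seq.
have zq := extends_keeping_setU1 zm mal eA.
exists (z `|` [set al], A); split.
- by split; [exact: closed_tree_setU1|exists al; right].
- have pA : {subset p.2 <= A} by move=> b bp; rewrite inE bp orbT.
  by split=> //; exact: extends_keeping_trans pA pz zq.
- by exists al => //; right.
- move=> /fz fzk; exists z, m; split=> //=; last by rewrite inE eqxx.
  apply: extends_keeping_setU1 zm mal _ => b; rewrite inE => /eqP ->.
  by apply: eA; rewrite inE eqxx.
Qed.

Lemma extends_trans p q r : extends p q -> extends q r -> extends p r.
Proof.
move=> [pq pqA] [qr qrA]; split; last by move=> b /pqA/qrA.
exact: extends_keeping_trans pqA pq qr.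
Qed.

(** * The limit of a sequence of states *)

Section Limit.
Context (q : nat -> state) (dl : W)
  (q_valid : forall i, valid (q i))
  (q_ext : forall i j, (i <= j)%N -> extends (q i) (q j))
  (q_lt : forall i c, (q i).1 c -> c < dl)
  (q_cofinal : forall a, a < dl -> exists i, exists2 c, (q i).1 c & a < c).
Let x : set W := \bigcup_i (q i).1 `|` [set dl].

Lemma limit_initial i : init (q i).1 x.
Proof.
split=> [c qc|c b qc]; first by left; exists i.
move=> [[j _ qb] bc|-> dlc]; last first.
  by have := le_lt_trans dlc (q_lt qc); rewrite ltxx.
have [ij|/ltnW ji] := leqP i j.
  by have [[[_ qP] _] _] := q_ext ij; exact: qP qc qb bc.
by have [[[qji _] _] _] := q_ext ji; exact: qji.
Qed.

(** A consecutive pair with upper element below [dl] already lies in some later [q k], which keeps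
    the promises of stage [i]. The top [dl] has no predecessor in [x], being a limit of elements of
    [x]. *)
Lemma limit_keeping i : extends_keeping (q i).1 (q i).2 x.
Proof.
split=> [|mu al b]; first exact: limit_initial.
case=> xmu [[j _ qal]|->] mual mumax nqal bA.
  have jk := leq_maxr i j; have ik := leq_maxl i j; set k := maxn i j in jk ik.
  have qkal : (q k).1 al by have [[[qjk _] _] _] := q_ext jk; exact: qjk.
  have [[_ keep] _] := q_ext ik; apply: keep bA => //.
  apply: (consecutive_initial (limit_initial k) qkal); split=> //.
  exact: (limit_initial k).1.
have [j [c qc muc]] := q_cofinal mual.
have := mumax c ((limit_initial j).1 _ qc) (q_lt qc).
by rewrite leNgt muc.
Qed.

(** A supremum below [dl] is exceeded by an element of some [q i], so all of [B] lies in this closed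
    node. *)
Lemma closed_tree_limit : S dl -> T x.
Proof.
move=> Sdl; split.
- by move=> c [[i _]|-> //]; have [[qS _ _] _] := q_valid i; exact: qS.
- apply: closed_from_sup => // B m Bx B0 mB; have [Bm mcof] := mB.
  have xdl c : x c -> c <= dl by case=> [[i _ /q_lt/ltW]|->].
  have : m <= dl.
    by rewrite leNgt; apply/negP => /mcof[b /Bx/xdl bdl]; rewrite ltNge bdl.
  rewrite le_eqVlt => /orP[/eqP ->|mdl]; first by right.
  have [i [c qc mc]] := q_cofinal mdl; left; exists i => //.
  have [[_ clq _] _] := q_valid i; apply: closed_sup clq B0 _ mB => b Bb.
  apply: (limit_initial i).2 qc (Bx _ Bb) _.
  by apply: le_trans (Bm _ Bb) (ltW mc).
- apply: countable_setU (countable1 dl); apply: bigcup_countable => // i _.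
  by have [[_ _ cq] _] := q_valid i.
Qed.

(* If [x] had the color [k], then [x] itself was a candidate at stage [k], so a
   node of color [k] adjacent to [x] was captured there. *)
Lemma limit_monochromatic (f : set W -> nat) : S dl ->
  (forall k, exists a, next_state f k a (q k) (q k.+1)) ->
  exists y, ladder_adj y x /\ f y = f x.
Proof.
move=> Sdl q_next; have [a [_ _ _ cap]] := q_next (f x).
have Tx := closed_tree_limit Sdl.
have [|y [b [Ty fy yb yq bq]]] := cap.
  by exists x; split=> //; [exists dl; right|exact: limit_keeping].
exists y; split=> //; apply/asboolP; split=> //; left; split.
  have [i [c qc bc]] : exists i, exists2 c, (q i).1 c & b < c.
    by apply: q_cofinal; apply: (q_lt (i := (f x).+1)); apply: yq.1.1; case: yb.
  move=> yx; have : y c by rewrite yx; left; exists i.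
  by move=> /yb.2; rewrite leNgt bc.
exists b => //; apply: extends_keeping_trans yq (limit_keeping _).
by move=> c; rewrite inE => /eqP ->.
Qed.
End Limit.

(** The choice of [dl] depends on the construction, while the construction must use every point
    below [dl] as a lower bound. So states [P w] are built for all finite words [w] of bounds; [S]
    meets the club of points closed under [P], and an enumeration of the points below the chosen
    [dl] yields the sequence. *)
Lemma ladder_monochromatic (f : set W -> nat) : stationary S ->
  exists x y, ladder_adj x y /\ f x = f y.
Proof.
move=> stS.
have /choice[g gP] (z : nat * W * state) :
    exists q, valid z.2 -> next_state f z.1.1 z.1.2 z.2 q.
  have [v|nv] := pselect (valid z.2); last by exists z.2.
  by have [q qP] := next_state_exists f z.1.1 z.1.2 v; exists q.
have [s0 [Ss0 _]] : S `&` setT !=set0.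
  apply: stS; first exact: closedT.
  by move=> a; have [b] := omega1_gt W_omega1 a; exists b.
(* The head of a word is the latest bound; the length of its tail is the color treated at that
   stage. *)
pose P := fix P w : state :=
  if w is a :: w' then g (size w', a, P w') else (set0 `|` [set s0], [::]).
have P_valid w : valid (P w).
  elim: w => [|a w IH] /=; last by have [] := gP (size w, a, P w) IH.
  split; last by exists s0; right.
  by apply: closed_tree_setU1 => //; split=> //; exact: closed0.
have P_next a w : next_state f (size w) a (P w) (P (a :: w)).
  exact: gP (size w, a, P w) (P_valid w).
have [|clC unC] := @club_closure_points _ _ W_omega1 (fun w => (P w).1).
  by move=> w; have [[]] := P_valid w.
have [dl [Sdl Cdl]] := stS _ clC unC.
have s0dl : s0 < dl by apply: (Cdl [::]) => //; right.
have /countable_injP[h h_inj] := countable_initial W_omega1 dl.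
(* The default [s0] is below [dl], so the values of [a] are exactly the points below [dl]. *)
pose a i := xget s0 [set b | b < dl /\ h b = i].
have a_lt i : a i < dl by rewrite /a; case: xgetP => [b _ []|].
have a_surj b : b < dl -> a (h b) = b.
  move=> bdl; have [_ hE] : a (h b) < dl /\ h (a (h b)) = h b.
    by apply: (@xgetPex _ s0 [set c | c < dl /\ h c = h b]); exists b.
  by apply: h_inj hE; apply/mem_set; exact: ltW.
pose w i := iteri i (fun j w => a j :: w) [::].
have size_w i : size (w i) = i by elim: i => //= i ->.
have w_lt i : {in w i, forall b, b < dl}.
  by elim: i => //= i IH b; rewrite inE => /orP[/eqP ->|/IH].
pose q i := P (w i).
have q_next i : next_state f i (a i) (q i) (q i.+1).
  by rewrite -{1}(size_w i); exact: P_next.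
have q_ext i j : (i <= j)%N -> extends (q i) (q j).
  elim: j => [|j IH].
    by rewrite leqn0 => /eqP ->; split=> //; exact: extends_keeping_refl.
  rewrite leq_eqVlt => /orP[/eqP ->|/IH ij].
    by split=> //; exact: extends_keeping_refl.
  by apply: extends_trans ij _; have [] := q_next j.
have q_lt i c : (q i).1 c -> c < dl by exact: Cdl (w_lt i) c.
(* The bound [b] is imposed at stage [h b], so the next node has an element above it. *)
have q_cofinal b : b < dl -> exists i, exists2 c, (q i).1 c & b < c.
  move=> /a_surj ab; exists (h b).+1.
  by have [_ _ + _] := q_next (h b); rewrite ab.
have q_step k : exists b, next_state f k b (q k) (q k.+1) by exists (a k).
have [y [yx fyx]] := limit_monochromatic (fun i => P_valid (w i)) q_ext q_lt
  q_cofinal Sdl q_step.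
by exists y, (\bigcup_i (q i).1 `|` [set dl]).
Qed.
End LadderGraph.

Theorem theorem2 (d : Order.disp_t) (W : orderTopologicalType d)
    (W_omega1 : is_omega1 W) (S : set W)
    (S_stationary : stationary S) (S_costationary : stationary (~` S)) :
  exists X : graph (set W),
    [/\ subgraph X (comparability_graph (closed_tree S) (@initial_segment d W)),
        chromatic_number_is X [set: W],
        (forall s t : set W, closed_tree S s -> closed_tree S t ->
           ~ comparable_in (@initial_segment d W) s t ->
           finitely_separated X s t) &
        (forall A : set (set W), A `<=` closed_tree S -> ~ countable A ->
           exists s t : set W,
             [/\ A s, A t, s <> t & finitely_separated X s t])].
Proof.
have [e e_inj] := exists_coherent_injections W_omega1.
have unS := stationary_unbounded W_omega1 S_stationary.
have [n n_unbounded] := exists_unbounded_level W_omega1 unS.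
exists (ladder_graph S e n); split.
- exact: ladder_subgraph.
- split; first exact: ladder_colorable.
  (* A countable set of colors embeds into the naturals, and then some edge is monochromatic. *)
  move=> U C [f [fC fP]]; have [cC|] := pselect (countable C); last first.
    exact: uncountable_card_ge.
  have /countable_injP[h h_inj] := cC.
  have [x [y [xy hxy]]] :=
    ladder_monochromatic W_omega1 e n_unbounded (h \o f) S_stationary.
  have [Tx Ty] := ladder_adj_vertices xy.
  by case: (fP _ _ xy); apply: h_inj hxy; apply/mem_set/fC.
- by move=> s t; exact: ladder_separated.
- move=> A AT ncA.
  have [s [t [As At nst]]] :=
    uncountable_incomparable W_omega1 S_costationary AT ncA.
  exists s, t; split=> //; last by apply: ladder_separated => //; exact: AT.
  by move=> st; apply: nst; rewrite st; left; split.
Qed.
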